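(* Let $n,m\in\mathbb{Z}^+$ with $m\geq 3$ and $n\geq 2$, and let $C_m$ be the cycle on $m$ vertices. Then $\chi_n(C_m) = \chi(C_m)$.
   Context: For a graph $G=(V,E)$, a $\mathbb{Z}$-labeling is a map $\ell:V\to\mathbb{Z}$; its order is the size of its range; it is proper if adjacent vertices get different labels; $\chi(G)$ is the minimum order of a proper labeling. $N[v]$ is the closed neighborhood of $v$. A closed coloring with nonzero remainders mod $n$ is a labeling with $\sum_{w\in N[v]}\ell(w)\not\equiv 0 \pmod n$ for all $v\in V$. $\chi_n(G)$ denotes the minimum order of a proper closed coloring with nonzero remainders mod $n$ of $G$. *)

(* Defs.v *)
From HB Require Import structures.
From mathcomp Require Import all_boot all_order all_algebra.
From mathcomp Require Import boolp.

Set Implicit Arguments.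
Unset Strict Implicit.
Unset Printing Implicit Defensive.

Import Order.TTheory GRing.Theory Num.Theory.

Local Open Scope ring_scope.

Record sgraph (V : finType) := SGraph {
  adj :> rel V;
  adj_sym : symmetric adj;
  adj_irr : irreflexive adj
}.

Section Labelings.
Variables (V : finType) (G : sgraph V).
Implicit Types (l : V -> int) (P : (V -> int) -> Prop).

Definition closed_nbhd (v : V) : {set V} := [set w | (w == v) || G v w].

Definition label_order l : nat := size (undup (codom l)).

Definition proper_labeling l : Prop := forall v w : V, G v w -> l v <> l w.

Definition closed_nonzero_rem (n : nat) l : Prop :=
  forall v : V, ~~ (\sum_(w in closed_nbhd v) l w == 0 %[mod n])%Z.

Definition is_order_of P : pred nat :=
  fun k => `[< exists2 l, P l & label_order l = k >].

Lemma proper_labeling_ex : exists k, is_order_of proper_labeling k.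
Proof.
pose l (v : V) : int := Posz (enum_rank v).
exists (label_order l); apply/asboolP; exists l => // v w Gvw [].
by move=> /val_inj/enum_rank_inj vw; rewrite vw adj_irr in Gvw.
Qed.

Definition chi : nat := ex_minn proper_labeling_ex.

Definition proper_closed_nonzero_rem (n : nat) l : Prop :=
  proper_labeling l /\ closed_nonzero_rem n l.

(* [None] when no such labeling exists, e.g. for n = 1 on a nonempty graph;
   so [chin n = Some k] also asserts that the minimum is attained. *)
Definition chin (n : nat) : option nat :=
  if pselect (exists k, is_order_of (proper_closed_nonzero_rem n) k) is left ex
  then Some (ex_minn ex) else None.

End Labelings.

(* The guard i != j only matters for m = 1; [ordS] is the successor mod m. *)
Definition cycle_adj (m : nat) : rel 'I_m :=
  fun i j => (i != j) && ((j == ordS i) || (i == ordS j)).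

Lemma cycle_adj_sym m : symmetric (@cycle_adj m).
Proof. by move=> i j; rewrite /cycle_adj eq_sym orbC. Qed.

Lemma cycle_adj_irr m : irreflexive (@cycle_adj m).
Proof. by move=> i; rewrite /cycle_adj eqxx. Qed.

Definition cycle_graph (m : nat) : sgraph 'I_m :=
  SGraph (@cycle_adj_sym m) (@cycle_adj_irr m).

(* Main.v *)
(* Both invariants equal 2 if m is even and 3 if m is odd. Going around the
   cycle, label the vertices a, b, a, b, ..., except that for odd m the last
   vertex gets c. Every closed neighbourhood then sums to a + 2b, 2a + b or
   a + b + c, and (a, b, c) = (1, 3, 5) makes these nonzero mod n for n = 2,
   as does (0, 1, n) for n >= 3. *)
Require Import Defs.
From HB Require Import structures.
From mathcomp Require Import all_boot all_order all_algebra.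
From mathcomp Require Import boolp zify.

Import Order.TTheory GRing.Theory Num.Theory.

Section Order.
Variables (V : finType) (G : sgraph V).
Implicit Types (l : V -> int) (s : seq int).

Lemma leq_label_order l s :
  uniq s -> {subset s <= codom l} -> (size s <= label_order l)%N.
Proof.
by move=> us ss; apply: uniq_leq_size => // x /ss; rewrite mem_undup.
Qed.

Lemma label_order_leq l s : (forall v, l v \in s) -> (label_order l <= size s)%N.
Proof.
move=> ls; apply: uniq_leq_size (undup_uniq _) _ => x.
by rewrite mem_undup => /codomP[v ->].
Qed.

Lemma chi_leq l : proper_labeling G l -> (chi G <= label_order l)%N.
Proof.
rewrite /chi => pl; case: ex_minnP => k _; apply.
by apply/asboolP; exists l.
Qed.

Lemma chi_attained : exists2 l, proper_labeling G l & label_order l = chi G.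
Proof. by rewrite /chi; case: ex_minnP => k /asboolP. Qed.

(** Every labeling counted by [chin] is proper, so [chi G] is a lower bound. The witness [l] makes
    the minimum exist, which rules out [None], and bounds it from above. *)
Lemma chin_eq_chi n l :
  proper_closed_nonzero_rem G n l -> (label_order l <= chi G)%N ->
  chin G n = Some (chi G).
Proof.
move=> pl lel; rewrite /chin; case: pselect => [ex|[]]; last first.
  by exists (label_order l); apply/asboolP; exists l.
congr Some; case: ex_minnP => k /asboolP[l' [pl' _] <-] min.
apply/eqP; rewrite eqn_leq (chi_leq _ pl') andbT (leq_trans _ lel) //.
by apply: min; apply/asboolP; exists l.
Qed.

End Order.

Section Cycle.
Variable m : nat.
Hypothesis hm : (3 <= m)%N.
Implicit Types i j : 'I_m.

Lemma ordS_val i : ordS i = (if i.+1 == m then 0 else i.+1)%N :> nat.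
Proof.
have := ltn_ord i; rewrite /=; case: eqP => [->|ne lt]; first by rewrite modnn.
by rewrite modn_small //; lia.
Qed.

Lemma ord_pred_val i : ord_pred i = (if i == 0 :> nat then m.-1 else i.-1) :> nat.
Proof.
have := ltn_ord i; rewrite /=; case: eqP => [->|ne lt]; first by rewrite modn_small; lia.
have -> : ((i + m).-1 = i.-1 + m)%N by lia.
by rewrite modnDr modn_small //; lia.
Qed.

Lemma cycle_graph_ordS i : cycle_graph m i (ordS i).
Proof.
rewrite /= /cycle_adj eqxx andbT -val_eqE; apply/eqP.
by rewrite [X in _ = X]ordS_val /=; have := ltn_ord i; case: eqP; lia.
Qed.

(** Since [m >= 3], a vertex, its successor and its predecessor are pairwise distinct, so no label
    is counted twice. *)
Lemma sum_closed_nbhd_cycle (l : 'I_m -> int) i :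
  (\sum_(w in closed_nbhd (cycle_graph m) i) l w
   = l i + l (ordS i) + l (ord_pred i))%R.
Proof.
have lti := ltn_ord i.
have Si : ordS i != i.
  by rewrite -val_eqE; apply/eqP; rewrite [LHS]ordS_val /=; case: eqP; lia.
have Pi : ord_pred i != i.
  by rewrite -val_eqE; apply/eqP; rewrite [LHS]ord_pred_val /=; case: eqP; lia.
have PS : ord_pred i != ordS i.
  rewrite -val_eqE; apply/eqP; rewrite [LHS]ord_pred_val [RHS]ordS_val.
  by case: eqP; case: eqP; lia.
rewrite (bigD1 i) ?inE ?eqxx //= (bigD1 (ordS i)) /=; last first.
  by rewrite inE cycle_graph_ordS orbT.
rewrite (bigD1 (ord_pred i)) /=; last first.
  rewrite inE Pi PS !andbT adj_sym.
  by have := cycle_graph_ordS (ord_pred i); rewrite ord_predK => ->; rewrite orbT.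
(* The remaining sum is empty: another neighbour [j] would satisfy [i = ordS j], hence be
   [ord_pred i]. *)
rewrite big1 ?addr0 ?addrA // => j /andP[/andP[/andP[]]].
rewrite inE /= /cycle_adj => + ji jS jP.
rewrite (negPf ji) (negPf jS) /= => /andP[_ /eqP ij].
by rewrite ij ordSK eqxx in jP.
Qed.

Lemma chi_cycle_ge2 : (2 <= chi (cycle_graph m))%N.
Proof.
have [l pl <-] := chi_attained _ (cycle_graph m).
pose i := Ordinal (ltnW (ltnW hm)); have /pl/eqP ll := cycle_graph_ordS i.
apply: (@leq_label_order _ l [:: l i; l (ordS i)]).
  by rewrite /= inE ll.
by move=> x; rewrite !inE => /orP[]/eqP->; apply: codom_f.
Qed.

(* With at most two labels, l (i + 2) = l i, so an odd cycle would give its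
   adjacent vertices 0 and m - 1 the same label. *)
Lemma chi_odd_cycle_ge3 : odd m -> (3 <= chi (cycle_graph m))%N.
Proof.
move=> om; have [l pl <-] := chi_attained _ (cycle_graph m).
rewrite leqNgt; apply/negP => lt3.
have per i : l (ordS (ordS i)) = l i.
  (* Otherwise three consecutive vertices carry three distinct labels. *)
  apply/eqP/negPn/negP => ne; move: lt3; rewrite ltnNge => /negP; apply.
  have /pl/eqP ne1 := cycle_graph_ordS i.
  have /pl/eqP ne2 := cycle_graph_ordS (ordS i).
  apply: (@leq_label_order _ l [:: l i; l (ordS i); l (ordS (ordS i))]).
    by rewrite /= !inE negb_or ne1 ne2 eq_sym ne.
  by move=> x; rewrite !inE => /or3P[]/eqP->; apply: codom_f.
pose i0 := Ordinal (ltnW (ltnW hm)).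
have even_l k j : j = k.*2 :> nat -> l j = l i0.
  elim: k j => [|k IHk] j jE; first by congr l; apply: val_inj.
  have lt := ltn_ord j.
  have ltk : (k.*2 < m)%N by lia.
  (* Two successor steps from [k.*2] reach [j] without wrapping, because [k.*2 + 2 = j < m]. *)
  rewrite -(IHk (Ordinal ltk)) // -[RHS]per; congr l; apply: val_inj.
  rewrite [RHS]ordS_val [nat_of_ord (ordS _)]ordS_val /= jE.
  by do ![case: ifP] => /=; lia.
have ltm : (m.-1 < m)%N by lia.
apply: (pl _ _ (cycle_graph_ordS (Ordinal ltm))).
rewrite (even_l m.-1./2) /=; last by lia.
by congr l; apply: val_inj; rewrite [RHS]ordS_val /=; case: eqP; lia.
Qed.

Section Alternating.
Variables a b c : int.

(** Parity is tested first, so [c] occurs only when [m.-1] is even, that is, when [m] is odd. *)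
Definition alt_label i : int :=
  if odd i then b else if i.+1 == m then c else a.

Lemma alt_label_proper :
  a != b -> a != c -> b != c -> proper_labeling (cycle_graph m) alt_label.
Proof.
move=> /eqP ab /eqP ac /eqP bc.
have alt_ordS i : alt_label i <> alt_label (ordS i).
  rewrite /alt_label ordS_val; have := ltn_ord i.
  by do ![case: ifP] => /=; lia.
move=> i j /= /andP[_ /orP[]/eqP->]; first exact: alt_ordS.
by move/esym; exact: alt_ordS.
Qed.

Lemma label_order_alt_label :
  (label_order alt_label <= if odd m then 3 else 2)%N.
Proof.
case: ifP => om.
  apply: (@label_order_leq _ _ [:: a; b; c]) => i.
  by rewrite /alt_label !inE; do ![case: ifP => _]; rewrite eqxx ?orbT.
apply: (@label_order_leq _ _ [:: a; b]) => i.
rewrite /alt_label !inE; case: ifP => oi; first by rewrite eqxx orbT.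
by case: (i.+1 =P m) => [iE|_]; [lia | rewrite eqxx].
Qed.

(** An even centre away from [c] gives [a + b + b], an odd one [a + a + b]. For odd [m], the centres
    [m - 2], [m - 1] and [0] see each label once. *)
Lemma sum_closed_nbhd_alt_label i :
  (\sum_(w in closed_nbhd (cycle_graph m) i) alt_label w)%R
  \in [:: a + b + b; a + a + b; a + b + c]%R.
Proof.
rewrite sum_closed_nbhd_cycle !inE /alt_label ordS_val ord_pred_val.
have := ltn_ord i.
by do ![case: ifP] => /=; lia.
Qed.

End Alternating.

Lemma chin_cycle_of_alt (n : nat) (a b c : int) :
  a != b -> a != c -> b != c ->
  all (fun x => ~~ (x == 0 %[mod n])%Z) [:: a + b + b; a + a + b; a + b + c]%R ->
  chin (cycle_graph m) n = Some (chi (cycle_graph m)).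
Proof.
move=> ab ac bc /allP nz; apply: (@chin_eq_chi _ _ _ (alt_label a b c)).
  split; first exact: alt_label_proper.
  by move=> i; apply/nz/sum_closed_nbhd_alt_label.
apply: leq_trans (label_order_alt_label a b c) _.
by case: ifP => [/chi_odd_cycle_ge3 //|_]; apply: chi_cycle_ge2.
Qed.

End Cycle.

Theorem theorem4p3 (n m : nat) (hm : (3 <= m)%N) (hn : (2 <= n)%N) :
  chin (cycle_graph m) n = Some (chi (cycle_graph m)).
Proof.
have [n2|n2] := eqVneq n 2%N.
  (* Three odd labels always have an odd sum; here the sums are 7, 5 and 9. *)
  by rewrite n2; apply: (@chin_cycle_of_alt _ hm 2 1%:Z 3%:Z 5%:Z).
have n3 : (2 < n)%N by rewrite ltn_neqAle eq_sym n2.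
(* The sums are 2, 1 and [1 + n], with residues 2, 1 and 1; the first is nonzero because [n > 2]. *)
apply: (@chin_cycle_of_alt _ hm n 0%:Z 1%:Z n%:Z); rewrite ?eqz_nat; try lia.
by rewrite /= !add0r modzDr mod0z !modz_small //; lia.
Qed.
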